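(* Let $p\ge 2$ be an integer. The lamplighter group $\mathbb{Z}_p\wr\mathbb{Z}$ embeds as a discrete, co-compact subgroup into the group $\mathcal{A}(p,p)$. The Diestel-Leader graph $\mathsf{DL}(p,p)$ is (isomorphic to) the Cayley graph of the lamplighter group $\mathbb{Z}_p\wr\mathbb{Z}$ with respect to the symmetric set of generators $$\{(\delta_1^{\ell},1),\ (\delta_0^{\ell},-1):\ \ell\in\mathbb{Z}_p\}.$$
   Context: Lamplighter group: $\mathbb{Z}_p=\{0,\dots,p-1\}$ is the cyclic group of order $p$. $\mathfrak{C}$ is the group, under pointwise addition mod $p$, of all functions $\eta:\mathbb{Z}\to\mathbb{Z}_p$ with finite support. For $k\in\mathbb{Z}$ let $L_k\eta(x)=\eta(x-k)$. Then $\mathbb{Z}_p\wr\mathbb{Z}=\mathfrak{C}\rtimes\mathbb{Z}$ is the set of pairs $(\eta,k)$ with product $(\eta,k)(\eta',k')=(\eta+L_k\eta',\,k+k')$. For $k\in\mathbb{Z}$ and $\ell\in\mathbb{Z}_p$, $\delta_k^{\ell}\in\mathfrak{C}$ is the configuration with value $\ell$ at $k$ and $0$ elsewhere. Cayley graph: for a group $G$ with finite symmetric generating set $S$, the Cayley graph has vertex set $G$, with $x\sim y$ if and only if $y=xs$ for some $s\in S$. Trees: $\mathbb{T}_p$ denotes the homogeneous tree in which every vertex has degree $p+1$, with a fixed root vertex $o$ and a fixed end $\varpi$ (an end is an equivalence class of geodesic rays, two rays being equivalent if they differ only by finite initial pieces). The predecessor $x^-$ of a vertex $x$ is the neighbour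 of $x$ on the unique geodesic ray from $x$ representing $\varpi$; the other $p$ neighbours are its successors. The Busemann function $\mathfrak{h}:\mathbb{T}_p\to\mathbb{Z}$ is determined by $\mathfrak{h}(o)=0$ and $\mathfrak{h}(x)=\mathfrak{h}(x^-)+1$ for all vertices $x$. Graph: $\mathsf{DL}(p,p)$ has vertex set $\{(x_1,x_2)\in\mathbb{T}_p\times\mathbb{T}_p:\ \mathfrak{h}(x_1)+\mathfrak{h}(x_2)=0\}$, and $(x_1,x_2)\sim(y_1,y_2)$ if and only if $x_1\sim y_1$ and $x_2\sim y_2$. Group: $\mathsf{Aff}(\mathbb{T}_p)$ is the group of all automorphisms $g$ of $\mathbb{T}_p$ with $g(x^-)=(gx)^-$ for all $x$; the homomorphism $\Phi:\mathsf{Aff}(\mathbb{T}_p)\to\mathbb{Z}$ is $\Phi(g)=\mathfrak{h}(gx)-\mathfrak{h}(x)$ (independent of $x$). Define $\mathcal{A}(p,p)=\{(g_1,g_2)\in\mathsf{Aff}(\mathbb{T}_p)\times\mathsf{Aff}(\mathbb{T}_p):\ \Phi(g_1)+\Phi(g_2)=0\}$, with the topology of pointwise convergence on vertices; it acts on $\mathsf{DL}(p,p)$ by $(x_1,x_2)\mapsto(g_1x_1,g_2x_2)$. A discrete subgroup is co-compact if the quotient of the group by it is compact. *)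

(* Defs.v *)
From HB Require Import structures.
From mathcomp Require Import all_boot all_order all_algebra.
From mathcomp Require Import generic_quotient.
From mathcomp Require Import all_classical.
From mathcomp Require Import topology.
From mathcomp Require Import zify ring.
Set Implicit Arguments.
Unset Strict Implicit.
Unset Printing Implicit Defensive.

Import Order.TTheory GRing.Theory Num.Theory.

Local Open Scope classical_set_scope.
Local Open Scope ring_scope.

(* For p <= 1 the library type 'Z_p has two elements: assume 1 < p. *)

Definition finsupp_pred (p : nat) : pred (int -> 'Z_p) :=
  fun eta => `[< finite_set [set x | eta x != 0] >].

Record config (p : nat) := Config {
  cfun :> int -> 'Z_p;
  cfun_finsupp : finsupp_pred cfun }.

HB.instance Definition _ (p : nat) := [isSub for @cfun p].
HB.instance Definition _ (p : nat) := [Choice of config p by <:].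

Lemma finsupp_zmod_closed p : zmod_closed (@finsupp_pred p).
Proof.
split=> [|f g /asboolP ff /asboolP fg]; apply/asboolP.
  by apply: (sub_finite_set _ (@finite_set0 int)) => x /eqP; apply.
have fU : finite_set ([set x | f x != 0] `|` [set x | g x != 0]).
  by rewrite finite_setU.
apply: (sub_finite_set _ fU) => x /= fgx.
have [f0|] := eqVneq (f x) 0; last by left.
right; apply: contraNneq fgx => g0.
by rewrite !fctE f0 g0 subr0.
Qed.

HB.instance Definition _ (p : nat) :=
  GRing.isZmodClosed.Build (int -> 'Z_p) (@finsupp_pred p)
    (@finsupp_zmod_closed p).
HB.instance Definition _ (p : nat) :=
  [SubChoice_isSubZmodule of config p by <:].

Lemma shift_subproof p (k : int) (eta : config p) :
  finsupp_pred (fun x => eta (x - k)).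
Proof.
apply/asboolP; have /asboolP ff := cfun_finsupp eta.
have := finite_image (fun x => x + k) ff.
apply: sub_finite_set => x /= ex; exists (x - k) => //.
by rewrite subrK.
Qed.

Definition shift p (k : int) (eta : config p) : config p :=
  Config (shift_subproof k eta).

Lemma delta_subproof p (k : int) (l : 'Z_p) :
  finsupp_pred (fun x => if x == k then l else 0).
Proof.
apply/asboolP; apply: (sub_finite_set _ (finite_set1 k)) => x /=.
by case: (eqVneq x k) => // _ /eqP.
Qed.

Definition delta p (k : int) (l : 'Z_p) : config p :=
  Config (delta_subproof k l).

Definition lamplighter (p : nat) : Type := (config p * int)%type.

HB.instance Definition _ (p : nat) :=
  Choice.copy (lamplighter p) (config p * int)%type.

Section LamplighterGroup.
Context {p : nat}.

Definition lamp_one : lamplighter p := (0, 0).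
Definition lamp_mul (g g' : lamplighter p) : lamplighter p :=
  (g.1 + shift g.2 g'.1, g.2 + g'.2).
Definition lamp_inv (g : lamplighter p) : lamplighter p :=
  (- shift (- g.2) g.1, - g.2).

Lemma config_eq (e f : config p) : e =1 f -> e = f.
Proof. by move=> ef; apply: val_inj; apply: funext. Qed.

Lemma configD (e f : config p) x : (e + f) x = e x + f x.
Proof. by []. Qed.

Lemma configN (e : config p) x : (- e) x = - e x.
Proof. by []. Qed.

Lemma lamp_mulA : associative lamp_mul.
Proof.
move=> g h k; congr (_, _); last exact: addrA.
apply: config_eq => x.
rewrite -[RHS]/((g.1 x + h.1 (x - g.2)) + k.1 (x - (g.2 + h.2))).
rewrite -[LHS]/(g.1 x + (h.1 (x - g.2) + k.1 (x - g.2 - h.2))).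
by rewrite addrA opprD addrA.
Qed.

Lemma lamp_mul1 : left_id lamp_one lamp_mul.
Proof.
move=> [e k]; congr (_, _); last exact: add0r.
by apply: config_eq => x; rewrite configD add0r /= subr0.
Qed.

Lemma lamp_mulr1 : right_id lamp_one lamp_mul.
Proof.
move=> [e k]; congr (_, _); last exact: addr0.
by apply: config_eq => x; rewrite configD addr0.
Qed.

Lemma lamp_mulV : left_inverse lamp_one lamp_inv lamp_mul.
Proof.
move=> [e k]; congr (_, _); last exact: addNr.
by apply: config_eq => x; rewrite configD configN addNr.
Qed.

Lemma lamp_mulrV : right_inverse lamp_one lamp_inv lamp_mul.
Proof.
move=> [e k]; congr (_, _); last exact: addrN.
apply: config_eq => x.
rewrite -[LHS]/(e x - e (x - k - - k)) -[RHS]/(0 : 'Z_p).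
by rewrite opprK subrK subrr.
Qed.

End LamplighterGroup.

HB.instance Definition _ (p : nat) :=
  isGroup.Build (lamplighter p) (@lamp_mulA p) (@lamp_mul1 p) (@lamp_mulr1 p)
    (@lamp_mulV p) (@lamp_mulrV p).

Definition lamp_gens (p : nat) : set (lamplighter p) :=
  range (fun l : 'Z_p => (delta 1 l, 1) : lamplighter p) `|`
  range (fun l : 'Z_p => (delta 0 l, - 1) : lamplighter p).
Arguments lamp_gens : clear implicits.

Record graph := Graph {
  gvertex : Type;
  gadj : gvertex -> gvertex -> Prop }.

Definition graph_iso (X Y : graph) : Prop :=
  exists f : gvertex X -> gvertex Y,
    bijective f /\ forall x y, gadj x y <-> gadj (f x) (f y).

Definition symmetric_set (G : groupType) (S : set G) : Prop :=
  forall s, S s -> S (s^-1)%g.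

Definition generates (G : groupType) (S : set G) : Prop :=
  forall H : groupClosed G, (forall s, S s -> s \in H) -> forall g, g \in H.

Definition cayley_graph (G : groupType) (S : set G) : graph :=
  @Graph G (fun x y => exists2 s, S s & y = (x * s)%g).

Section Trees.
Context {V : choiceType}.
Implicit Types (adj : rel V) (r s : nat -> V).

Definition connected_graph adj : Prop :=
  forall x y, exists2 w, path adj x w & last x w = y.

(* A circuit has at least three vertices: backtracking along an edge is a
   [ucycle] of size two. *)
Definition acyclic_graph adj : Prop :=
  forall c : seq V, (2 < size c)%N -> ~ ucycle adj c.

Definition has_walk adj (x y : V) (n : nat) : Prop :=
  exists2 w, path adj x w & size w = n /\ last x w = y.

Definition is_dist adj (x y : V) (n : nat) : Prop :=
  has_walk adj x y n /\ forall m, has_walk adj x y m -> (n <= m)%N.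

Definition geodesic_ray adj r : Prop :=
  forall i j, (i <= j)%N -> is_dist adj (r i) (r j) (j - i).

Definition ray_equiv r s : Prop :=
  exists m n, forall k, r (m + k)%N = s (n + k)%N.

Definition is_end adj (w : set (nat -> V)) : Prop :=
  exists2 r, geodesic_ray adj r &
    w = [set s | geodesic_ray adj s /\ ray_equiv r s].

End Trees.

Section TreeLemmas.
Context {V : choiceType} {adj : rel V}.
Context (adjC : symmetric adj) (adjI : irreflexive adj)
  (adjA : acyclic_graph adj).
Implicit Types (x y : V) (w : seq V) (r s : nat -> V).

Lemma simple_path_uniq x w1 w2 :
  path adj x w1 -> uniq (x :: w1) -> path adj x w2 -> uniq (x :: w2) ->
  last x w1 = last x w2 -> w1 = w2.
Proof.
elim: w1 x w2 => [|a w1 IH] x [|b w2] //.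
- move=> _ _ _ /= /andP[/negP xw2 _] xE.
  by case: xw2; rewrite {1}xE mem_last.
- move=> _ /= /andP[/negP xw1 _] _ _ xE.
  by case: xw1; rewrite -{1}xE mem_last.
have [<- /=|nab] := eqVneq a b.
  move=> /andP[_ p1] /andP[_ u1] /andP[_ p2] /andP[_ u2] lE.
  by congr (_ :: _); apply: IH lE.
move=> p1 u1 p2 u2 /= lE; exfalso.
have hasz : has (mem (b :: w2)) (a :: w1).
  by apply/hasP; exists (last a w1); rewrite ?mem_last//= lE mem_last.
move: p1 u1 nab; move E1 : (a :: w1) hasz => c1 hasz.
move: hasz E1 => /split_find[z s1 s2 zb disj] E1.
rewrite cat_path cons_uniq cat_uniq mem_cat negb_or.
move=> /andP[p1 _] /andP[/andP[xs1 _] /and3P[u1 _ _]] nab.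
have {}zb : z \in b :: w2 := zb.
move: zb p2 u2 disj; move E2 : (b :: w2) => c2 zb.
case/splitPr: zb E2 => q1 q2 E2.
rewrite -cat_rcons cat_path cons_uniq cat_uniq mem_cat negb_or.
move=> /andP[p2 _] /andP[/andP[xq1 _] /and3P[u2 _ _]] disj.
have q1s1 y : y \in q1 -> y \notin s1.
  move=> yq; apply/negP => ys; move/negP: disj; apply.
  by apply/hasP; exists y => //=; rewrite mem_cat mem_rcons inE yq orbT.
have zs1 : z \notin s1 by move: u1; rewrite rcons_uniq => /andP[].
have zq1 : z \notin q1 by move: u2; rewrite rcons_uniq => /andP[].
have uq1 : uniq q1 by move: u2; rewrite rcons_uniq => /andP[].
apply: (adjA (c := x :: rcons s1 z ++ rev q1)).
  rewrite /= size_cat size_rcons size_rev !ltnS.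
  case: s1 E1 {p1 xs1 u1 disj q1s1 zs1} => [[aE _]|] //=.
  case: q1 E2 {p2 xq1 u2 zq1 uq1} => [[bE _]|] //=.
  by rewrite aE bE eqxx in nab.
apply/andP; split; last first.
  rewrite /= mem_cat negb_or xs1 mem_rev cat_uniq u1 rev_uniq uq1 andbT /=.
  move: xq1; rewrite mem_rcons inE negb_or => /andP[_ ->] /=.
  apply/hasPn => y; rewrite mem_rev => yq.
  rewrite mem_rcons inE negb_or (q1s1 _ yq) andbT.
  by apply: contraNneq zq1 => <-.
rewrite /= rcons_cat cat_path p1 last_rcons /= -rev_cons.
have := rev_path adj x (rcons q1 z).
rewrite last_rcons belast_rcons => ->.
by rewrite (eq_path (e' := adj)) // => u v; rewrite /= adjC.
Qed.

Lemma simple_is_dist x w :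
  path adj x w -> uniq (x :: w) -> is_dist adj x (last x w) (size w).
Proof.
move=> pw uw; split; first by exists w.
move=> m [v pv [<- vE]].
case/shortenP: pv vE => v' pv' uv' sub vE.
have -> : w = v' by apply: (simple_path_uniq pw uw pv' uv').
by apply: uniq_leq_size => //; case/andP: uv'.
Qed.

Definition seg r i n := [seq r k | k <- iota i.+1 n].

Lemma seg_last r i n : last (r i) (seg r i n) = r (i + n)%N.
Proof.
by elim: n i => [|n IH] i /=; rewrite ?addn0 // IH addSnnS.
Qed.

Lemma seg_path r i n :
  (forall k, adj (r k) (r k.+1)) -> path adj (r i) (seg r i n).
Proof. by move=> ra; elim: n i => //= n IH i; rewrite ra IH. Qed.

Lemma seg_uniq r i n : injective r -> uniq (r i :: seg r i n).
Proof.
move=> ri; have -> : r i :: seg r i n = [seq r k | k <- iota i n.+1] by [].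
by rewrite map_inj_uniq // iota_uniq.
Qed.

Lemma geodesic_ray_adj r k : geodesic_ray adj r -> adj (r k) (r k.+1).
Proof.
move=> /(_ k k.+1 (leqnSn k))[]; rewrite subSnn => -[w pw [sw lw]] _.
by case: w sw pw lw => [|a []] //= _; rewrite andbT => + <-.
Qed.

Lemma geodesic_ray_inj r : geodesic_ray adj r -> injective r.
Proof.
move=> gr; have lei i j : (i <= j)%N -> r i = r j -> i = j.
  move=> ij rij; have [_ /(_ 0%N)] := gr i j ij.
  rewrite rij leqn0 subn_eq0 => H; apply/eqP; rewrite eqn_leq ij /=.
  by apply: H; exists [::].
move=> i j rij; have [|/ltnW] := leqP i j; first by move=> /lei; exact.
by move=> /lei ->.
Qed.

Lemma simple_geodesic_ray r :
  (forall k, adj (r k) (r k.+1)) -> injective r -> geodesic_ray adj r.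
Proof.
move=> ra ri i j ij.
have := simple_is_dist (seg_path i (j - i) ra) (seg_uniq i (j - i) ri).
by rewrite seg_last subnKC // size_map size_iota.
Qed.

Lemma geodesic_ray_shift r a :
  geodesic_ray adj r -> geodesic_ray adj (fun k => r (a + k)%N).
Proof.
move=> gr; apply: simple_geodesic_ray => [k|i j /(geodesic_ray_inj gr)].
  by rewrite addnS; exact: geodesic_ray_adj.
by move/addnI.
Qed.

Definition cons_ray y r : nat -> V := fun n => if n is m.+1 then r m else y.

Lemma geodesic_ray_cons y r :
  geodesic_ray adj r -> adj y (r 0%N) -> y != r 1%N ->
  geodesic_ray adj (cons_ray y r).
Proof.
move=> gr yr0 yr1; have ra k := geodesic_ray_adj k gr.
have ri := geodesic_ray_inj gr.
have nyr k : y != r k.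
  apply/eqP => yE; case: k yE => [yE|[yE|k yE]].
  - by move: yr0; rewrite yE adjI.
  - by rewrite yE eqxx in yr1.
  apply: (adjA (c := r 0%N :: seg r 0 k.+2)) => //.
  apply/andP; split; last exact: seg_uniq.
  by rewrite [cycle _ _]/= rcons_path seg_path // seg_last -yE !ra yr0.
apply: simple_geodesic_ray; first by case.
move=> [|i] [|j] //= => [yE|yE|/ri -> //].
  by have := nyr j; rewrite -yE eqxx.
by have := nyr i; rewrite yE eqxx.
Qed.

Lemma ray_equiv_sym r s : ray_equiv r s -> ray_equiv s r.
Proof. by move=> [m [n rs]]; exists n, m => k; rewrite rs. Qed.

Lemma ray_equiv_trans r s t :
  ray_equiv r s -> ray_equiv s t -> ray_equiv r t.
Proof.
move=> [m [n rs]] [m' [n' st]]; exists (m + m')%N, (n' + n)%N => k.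
by rewrite -addnA rs addnCA st addnA.
Qed.

End TreeLemmas.

(* The homogeneous tree of degree p + 1 with its root and its end is unique up
   to isomorphism; a term of this type is any copy of it. *)
Record horo_tree (p : nat) := HoroTree {
  vert :> choiceType;
  adj : rel vert;
  adj_sym : symmetric adj;
  adj_irr : irreflexive adj;
  adj_connected : connected_graph adj;
  adj_acyclic : acyclic_graph adj;
  adj_degree : forall x, ([set y | adj x y] #= `I_p.+1)%card;
  root : vert;
  bend : set (nat -> vert);
  bend_end : is_end adj bend }.
Arguments adj {p h}.
Arguments root {p}.
Arguments bend {p}.

Section Horocycles.
Context {p : nat} {T : horo_tree p}.
Implicit Types (x y z : T) (r s : nat -> T).

Definition is_pred x y : Prop := exists2 r, bend T r & r 0%N = x /\ r 1%N = y.

(* [xget x P] is an element of P if there is one (otherwise x): here it is the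
   unique one, by [is_pred_ex] and [is_pred_uniq]. *)
Definition pred_vertex x : T := xget x [set y | is_pred x y].

Definition is_busemann (h : T -> int) : Prop :=
  h (root T) = 0 /\ forall x, h x = h (pred_vertex x) + 1.

(* The unique function with [is_busemann], by [busemannP] and
   [busemann_uniq]. *)
Definition busemann : T -> int := xget (fun=> 0) is_busemann.

Let simpleP := simple_path_uniq (@adj_sym p T) (@adj_acyclic p T).
Let consP :=
  geodesic_ray_cons (@adj_sym p T) (@adj_irr p T) (@adj_acyclic p T).
Let shiftP := geodesic_ray_shift (@adj_sym p T) (@adj_acyclic p T).

Lemma bend_geodesic r : bend T r -> geodesic_ray adj r.
Proof. by have [r0 _ ->] := bend_end T; case. Qed.

Lemma bend_equiv r s : bend T r -> bend T s -> ray_equiv r s.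
Proof.
have [r0 _ ->] := bend_end T => -[_ r0r] [_ r0s].
exact: ray_equiv_trans (ray_equiv_sym r0r) r0s.
Qed.

Lemma bend_closed r s :
  bend T r -> geodesic_ray adj s -> ray_equiv r s -> bend T s.
Proof.
have [r0 _ ->] := bend_end T => -[_ r0r] gs rs; split=> //.
exact: ray_equiv_trans r0r rs.
Qed.

Lemma bend_shift r a : bend T r -> bend T (fun k => r (a + k)%N).
Proof.
move=> br; apply: (bend_closed br); first exact/shiftP/bend_geodesic.
by exists a, 0%N.
Qed.

Lemma bend_cons r y :
  bend T r -> adj y (r 0%N) -> y != r 1%N -> bend T (cons_ray y r).
Proof.
move=> br yr0 yr1; apply: (bend_closed br).
  exact/consP/yr1/yr0/bend_geodesic.
by exists 0%N, 1%N.
Qed.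

Lemma bend_from x : exists2 r, bend T r & r 0%N = x.
Proof.
have [r0 gr0 bE] := bend_end T.
have br0 : bend T r0.
  by rewrite bE; split=> //; exists 0%N, 0%N.
have [w pw <-] := adj_connected (r0 0%N) x.
elim/last_ind: w pw => [_|w y IH]; first by exists r0.
rewrite rcons_path last_rcons => /andP[/IH[r br rE] ay].
have [yE|yr1] := eqVneq y (r 1%N).
  by exists (fun k => r (1 + k)%N); [exact: bend_shift|rewrite yE].
by exists (cons_ray y r) => //; apply: bend_cons => //; rewrite rE adj_sym.
Qed.

Lemma is_pred_ex x : exists y, is_pred x y.
Proof. by have [r br rE] := bend_from x; exists (r 1%N), r. Qed.

Lemma is_pred_uniq x y z : is_pred x y -> is_pred x z -> y = z.
Proof.
move=> [r br [r0 <-]] [s bs [s0 <-]].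
have gr := bend_geodesic br; have gs := bend_geodesic bs.
have [m [n rs]] := bend_equiv br bs.
have pr k : path adj x (seg r 0 k).
  by rewrite -r0; apply: seg_path => i; exact: geodesic_ray_adj.
have ps k : path adj x (seg s 0 k).
  by rewrite -s0; apply: seg_path => i; exact: geodesic_ray_adj.
have ur k : uniq (x :: seg r 0 k).
  by rewrite -r0; apply: seg_uniq; exact: geodesic_ray_inj gr.
have us k : uniq (x :: seg s 0 k).
  by rewrite -s0; apply: seg_uniq; exact: geodesic_ray_inj gs.
have lE : last x (seg r 0 (m + 1)) = last x (seg s 0 (n + 1)).
  by rewrite -{1}r0 -s0 !seg_last !add0n rs.
have := simpleP (pr _) (ur _) (ps _) (us _) lE.
by rewrite !addn1 => -[].
Qed.

Lemma pred_vertexP x : is_pred x (pred_vertex x).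
Proof. by rewrite /pred_vertex; apply: xgetPex; exact: is_pred_ex. Qed.

Lemma pred_vertexE x y : is_pred x y -> pred_vertex x = y.
Proof. exact/is_pred_uniq/pred_vertexP. Qed.

Lemma bend_pred r k : bend T r -> pred_vertex (r k) = r k.+1.
Proof.
move=> br; apply: pred_vertexE; exists (fun i => r (k + i)%N).
  exact: bend_shift.
by rewrite addn0 addn1.
Qed.

Lemma bend_iter r k : bend T r -> iter k pred_vertex (r 0%N) = r k.
Proof. by move=> br; elim: k => //= k ->; rewrite bend_pred. Qed.

Lemma adj_pred x : adj x (pred_vertex x).
Proof.
have [r br [<- <-]] := pred_vertexP x.
exact/geodesic_ray_adj/bend_geodesic.
Qed.

Lemma adjP x y : adj x y <-> y = pred_vertex x \/ x = pred_vertex y.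
Proof.
split=> [axy|[->|->]]; [|exact: adj_pred|by rewrite adj_sym adj_pred].
have [r br [r0 r1]] := pred_vertexP x.
have [yE|yr1] := eqVneq y (r 1%N); first by left; rewrite yE.
right; symmetry; apply: pred_vertexE; exists (cons_ray y r) => //.
by apply: bend_cons => //; rewrite r0 adj_sym.
Qed.

Lemma iter_pred_inj x m n :
  iter m pred_vertex x = iter n pred_vertex x -> m = n.
Proof.
have [r br <-] := bend_from x; rewrite !bend_iter //.
exact/geodesic_ray_inj/bend_geodesic.
Qed.

Lemma iter_pred_meet x y :
  exists m n, iter m pred_vertex x = iter n pred_vertex y.
Proof.
have [r br <-] := bend_from x; have [s bs <-] := bend_from y.
have [m [n rs]] := bend_equiv br bs.
by exists m, n; rewrite !bend_iter //; have := rs 0%N; rewrite !addn0.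
Qed.

Lemma busemann_ex : exists h, is_busemann h.
Proof.
have /choice[f fP] x : exists mn : nat * nat,
    iter mn.1 pred_vertex x = iter mn.2 pred_vertex (root T).
  by have [m [n mn]] := iter_pred_meet x (root T); exists (m, n).
exists (fun x => (f x).1%:Z - (f x).2%:Z); split=> [|x].
  by rewrite (iter_pred_inj (fP (root T))) subrr.
have e1 : iter ((f (pred_vertex x)).1.+1 + (f x).2) pred_vertex x =
          iter ((f (pred_vertex x)).2 + (f x).1) pred_vertex x.
  rewrite addnC iterD iterSr fP -iterD addnC iterD -fP -iterD addnC.
  by rewrite addnC.
have /(congr1 (fun n => n%:Z)) := iter_pred_inj e1.
rewrite !PoszD -addn1 PoszD => e2.
apply/eqP; rewrite -subr_eq0; apply/eqP.
move: e2; set a := (f _).1%:Z; set b := (f _).2%:Z.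
set c := (f _).2%:Z; set d := (f _).1%:Z => e2.
have -> : d = a + 1 + b - c by rewrite e2 addrC addKr.
by rewrite addrAC -!addrA; ring.
Qed.

Lemma busemannP : is_busemann busemann.
Proof. by apply: xgetPex; exact: busemann_ex. Qed.

Lemma busemann_uniq h : is_busemann h -> h = busemann.
Proof.
suff H h1 h2 : is_busemann h1 -> is_busemann h2 -> h1 = h2.
  by move=> hP; apply: H => //; exact: busemannP.
have it h' : is_busemann h' -> forall n x,
    h' (iter n pred_vertex x) = h' x - n%:Z.
  move=> [_ h'P]; elim=> [|n IH] x; first by rewrite subr0.
  apply: (addIr 1); rewrite iterS -h'P IH.
  by rewrite -addn1 PoszD opprD addrA subrK.
move=> h1P h2P; apply: funext => x.
have [m [n mn]] := iter_pred_meet x (root T).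
apply: (addIr (- m%:Z)); rewrite -!it // mn !it //.
by case: h1P => -> _; case: h2P => -> _.
Qed.

End Horocycles.

Arguments busemann {p}.

Section Affine.
Context {p : nat} {T : horo_tree p}.

Definition is_automorphism (g : T -> T) : Prop :=
  bijective g /\ forall x y, adj (g x) (g y) = adj x y.

Definition aff_pred : pred (T -> T) := fun g =>
  `[< is_automorphism g /\
      forall x, g (pred_vertex x) = pred_vertex (g x) >].

End Affine.

Record aff (p : nat) (T : horo_tree p) := Aff {
  aff_fun :> T -> T;
  aff_funP : aff_pred aff_fun }.

HB.instance Definition _ (p : nat) (T : horo_tree p) :=
  [isSub for @aff_fun p T].
HB.instance Definition _ (p : nat) (T : horo_tree p) :=
  [Choice of aff T by <:].

Section AffineGroup.
Context {p : nat} {T : horo_tree p}.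
Implicit Types g : aff T.

Lemma aff_one_subproof : aff_pred (@id T).
Proof. by apply/asboolP; split=> //; split=> //; exists id. Qed.

Definition aff_one : aff T := Aff aff_one_subproof.

Lemma aff_mul_subproof g g' : aff_pred (g \o g').
Proof.
have /asboolP[[bg ag] pg] := aff_funP g.
have /asboolP[[bg' ag'] pg'] := aff_funP g'.
apply/asboolP; split=> [|x /=]; last by rewrite pg' pg.
by split=> [|x y /=]; [exact: bij_comp | rewrite ag ag'].
Qed.

Definition aff_mul g g' : aff T := Aff (aff_mul_subproof g g').

Lemma aff_inv_ex g : exists h : aff T, cancel g h /\ cancel h g.
Proof.
have /asboolP[[[h gK hK] ag] pg] := aff_funP g.
suff hP : aff_pred h by exists (Aff hP).
apply/asboolP; split; last by move=> x; rewrite -{1}(hK x) -pg gK.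
by split; [exists g | move=> x y; rewrite -ag !hK].
Qed.

Definition aff_inv g : aff T := xget g [set h | cancel g h /\ cancel h g].

Lemma aff_invP g : cancel g (aff_inv g) /\ cancel (aff_inv g) g.
Proof.
exact: (@xgetPex _ g [set h : aff T | cancel g h /\ cancel h g]
  (aff_inv_ex g)).
Qed.

Lemma aff_eq g g' : g =1 g' -> g = g'.
Proof. by move=> gg'; apply: val_inj; apply: funext. Qed.

Lemma aff_mulA : associative aff_mul.
Proof. by move=> g h k; apply: aff_eq. Qed.

Lemma aff_mul1 : left_id aff_one aff_mul.
Proof. by move=> g; apply: aff_eq. Qed.

Lemma aff_mulr1 : right_id aff_one aff_mul.
Proof. by move=> g; apply: aff_eq. Qed.

Lemma aff_mulV : left_inverse aff_one aff_inv aff_mul.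
Proof. by move=> g; apply: aff_eq; case: (aff_invP g). Qed.

Lemma aff_mulrV : right_inverse aff_one aff_inv aff_mul.
Proof. by move=> g; apply: aff_eq; case: (aff_invP g). Qed.

HB.instance Definition _ :=
  isGroup.Build (aff T) aff_mulA aff_mul1 aff_mulr1 aff_mulV aff_mulrV.

(* By [PhiE] the root can be replaced by any other vertex. *)
Definition Phi g : int := busemann T (g (root T)) - busemann T (root T).

Lemma PhiE g (x : T) : Phi g = busemann T (g x) - busemann T x.
Proof.
have [_ hP] := busemannP (T := T).
have /asboolP[_ pg] := aff_funP g.
have st y : busemann T (g (pred_vertex y)) - busemann T (pred_vertex y) =
            busemann T (g y) - busemann T y.
  by rewrite pg (hP y) (hP (g y)) opprD addrACA subrr addr0.
have it n y : busemann T (g (iter n pred_vertex y)) -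
    busemann T (iter n pred_vertex y) = busemann T (g y) - busemann T y.
  by elim: n => //= n IH; rewrite st.
have [m [n mn]] := iter_pred_meet (root T) x.
by rewrite /Phi -(it m) mn it.
Qed.

Lemma PhiM g g' : Phi (g * g')%g = Phi g + Phi g'.
Proof. by rewrite (PhiE g (g' (root T))) /Phi addrA subrK. Qed.

Lemma Phi1 : Phi 1%g = 0.
Proof. by rewrite /Phi subrr. Qed.

Lemma PhiV g : Phi (g^-1)%g = - Phi g.
Proof. by apply/eqP; rewrite -addr_eq0 -PhiM mulVg Phi1. Qed.

Definition horoprod_pred : pred (aff T * aff T) :=
  fun u => Phi u.1 + Phi u.2 == 0.

Lemma horoprod_group_closed : group_closed horoprod_pred.
Proof.
split; first by apply/eqP; rewrite /= !Phi1 addr0.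
move=> u v /eqP u0 /eqP v0; apply/eqP.
by rewrite /= !PhiM !PhiV addrACA u0 -opprD v0 oppr0 addr0.
Qed.

End AffineGroup.

Record horoprod (p : nat) (T : horo_tree p) := Horoprod {
  horoprod_val :> aff T * aff T;
  horoprod_valP : horoprod_pred horoprod_val }.

HB.instance Definition _ (p : nat) (T : horo_tree p) :=
  [isSub for @horoprod_val p T].
HB.instance Definition _ (p : nat) (T : horo_tree p) :=
  [Choice of horoprod T by <:].
HB.instance Definition _ (p : nat) (T : horo_tree p) :=
  SubChoice_isSubGroup.Build (aff T * aff T)%type (@horoprod_pred p T)
    (horoprod T) (@horoprod_group_closed p T).

Definition horoprod_eval (p : nat) (T : horo_tree p) (g : horoprod T) :
    {ptws T -> discrete_topology T} * {ptws T -> discrete_topology T} :=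
  (g.1 : T -> T, g.2 : T -> T).

HB.instance Definition _ (p : nat) (T : horo_tree p) :=
  Topological.copy (horoprod T) (initial_topology (@horoprod_eval p T)).

Definition discrete_subset (X : topologicalType) (H : set X) : Prop :=
  H `<=` isolated H.

Section Cosets.
Context {G : groupType}.
Implicit Types H : set G.

Definition lcoset_set H (x : G) : set G := [set (x * h)%g | h in H].

(* For any set H this is an equivalence relation; for a subgroup H its classes
   are the left cosets of H. *)
Definition same_lcoset H : rel G :=
  fun x y => `[< lcoset_set H x = lcoset_set H y >].

Lemma same_lcoset_refl H : reflexive (same_lcoset H).
Proof. by move=> x; apply/asboolP. Qed.

Lemma same_lcoset_sym H : symmetric (same_lcoset H).
Proof. by move=> x y; apply/asboolP/asboolP => ->. Qed.

Lemma same_lcoset_trans H : transitive (same_lcoset H).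
Proof. by move=> x y z /asboolP yx /asboolP xz; apply/asboolP; rewrite yx. Qed.

Canonical same_lcoset_equiv H := EquivRel (same_lcoset H)
  (same_lcoset_refl H) (same_lcoset_sym H) (@same_lcoset_trans H).

Definition lcoset_space H := {eq_quot same_lcoset H}%qT.

End Cosets.

Definition cocompact (p : nat) (T : horo_tree p) (H : set (horoprod T)) :
    Prop :=
  compact [set: quotient_topology (lcoset_space H)].

Definition DL_pred (p : nat) (T : horo_tree p) : pred (T * T) :=
  fun x => busemann T x.1 + busemann T x.2 == 0.

Definition DL (p : nat) (T : horo_tree p) : graph :=
  @Graph {x : T * T | DL_pred x}
    (fun x y => adj (val x).1 (val y).1 /\ adj (val x).2 (val y).2).

(* A concrete [horo_tree p]: (k, q) is the vertex at level k whose successors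
   are the (k + 1, q * 'X + l%:P). *)
Section HoroTreeModel.
Context (p : nat) (hp : (1 < p)%N).

Let V : choiceType := (int * {poly 'Z_p})%type.
Let prd (x : V) : V := (x.1 - 1, drop_poly 1 x.2).
Let scc (x : V) (l : 'Z_p) : V := (x.1 + 1, x.2 * 'X + l%:P).
Let adjV : rel V := fun x y => (y == prd x) || (x == prd y).

Let sccK x l : prd (scc x l) = x.
Proof.
case: x => k q; rewrite /prd /scc /= addrK addrC -['X]expr1.
by rewrite drop_polyDMXn // size_polyC leq_b1.
Qed.

Let prdE x y : x = prd y -> y = scc x (y.2)`_0.
Proof.
case: y => k q -> /=; rewrite /scc /= subrK; congr (_, _).
rewrite -{1}(poly_take_drop 1 q) expr1 addrC; congr (_ + _).
apply/polyP => i; rewrite coef_take_poly coefC.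
by case: i.
Qed.

Let iter_prd n x : iter n prd x = (x.1 - n%:Z, drop_poly n x.2).
Proof.
elim: n => [|n IH] /=; first by rewrite subr0 drop_poly0l -surjective_pairing.
rewrite IH /prd /=; congr (_, _).
  by rewrite (_ : n.+1%:Z = n%:Z + 1) ?opprD ?addrA // -PoszD addn1.
by apply/polyP => i; rewrite !coef_drop_poly addn1 addSnnS.
Qed.

Let adjV_sym : symmetric adjV.
Proof. by move=> x y; rewrite /adjV orbC. Qed.

Let prd_lv x y : x = prd y -> y.1 = x.1 + 1.
Proof. by move=> -> /=; rewrite subrK. Qed.

Let lv_neq (k : int) : k != k + 1.
Proof. by rewrite -subr_eq0 opprD addrA subrr add0r oppr_eq0. Qed.

Let adjV_irr : irreflexive adjV.
Proof.
move=> x; rewrite /adjV orbb; apply/negP => /eqP /prd_lv /eqP.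
exact/negP/lv_neq.
Qed.

Let adj_iter n x : exists2 w, path adjV x w & last x w = iter n prd x.
Proof.
elim: n => [|n [w pw lw]]; first by exists [::].
exists (rcons w (iter n.+1 prd x)); last by rewrite last_rcons.
by rewrite rcons_path pw lw /= /adjV eqxx.
Qed.

Let meet x y : exists m n, iter m prd x = iter n prd y.
Proof.
pose N := (size x.2 + size y.2)%N.
have [xy|yx] := lerP x.1 y.1.
  exists N, (N + `|y.1 - x.1|)%N; rewrite !iter_prd; congr (_, _).
    rewrite PoszD gez0_abs ?subr_ge0 //.
    by ring.
  by rewrite !drop_poly_eq0 // /N; lia.
exists (N + `|x.1 - y.1|)%N, N; rewrite !iter_prd; congr (_, _).
  rewrite PoszD gez0_abs ?subr_ge0 1?ltW //.
  by ring.
by rewrite !drop_poly_eq0 // /N; lia.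
Qed.

Let adjV_connected : connected_graph adjV.
Proof.
move=> x y; have [m [n mn]] := meet x y.
have [w pw lw] := adj_iter m x; have [v pv lv] := adj_iter n y.
exists (w ++ rev (belast y v)); last first.
  rewrite last_cat lw mn -lv.
  by case: v {pv lv} => //= a v; rewrite rev_cons last_rcons.
rewrite cat_path pw lw mn -lv rev_path.
by rewrite (eq_path (e' := adjV)) // => a b; rewrite /= adjV_sym.
Qed.

Let max_lv (c : seq V) : c != [::] ->
  exists2 x, x \in c & forall y, y \in c -> y.1 <= x.1.
Proof.
elim: c => // a [_ _|b c /(_ isT)[x xc xm] _].
  by exists a; rewrite ?mem_head // => y; rewrite inE => /eqP ->.
have [ax|xa] := lerP a.1 x.1.
  exists x; first by rewrite inE xc orbT.
  by move=> y; rewrite inE => /predU1P[->|/xm].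
exists a; first by rewrite mem_head.
by move=> y; rewrite inE => /predU1P[->//|/xm yx]; apply: le_trans yx (ltW xa).
Qed.

Let adjV_top x y : adjV x y -> y.1 <= x.1 -> y = prd x.
Proof.
move=> /orP[/eqP//|/eqP/prd_lv ->]; rewrite -subr_ge0 opprD addrA subrr add0r.
by [].
Qed.

Let adjV_acyclic : acyclic_graph adjV.
Proof.
move=> c sc uc; have [|x xc xm] := @max_lv c; first by case: c sc {uc}.
have [i s cE] := rot_to xc.
have xm' y : y \in x :: s -> y.1 <= x.1.
  by rewrite -cE mem_rot; exact: xm.
have ss : (1 < size s)%N by move: sc; rewrite -(size_rot i) cE.
move: uc; rewrite -(rot_ucycle i) cE => /andP[].
case: s {cE} xm' ss => // y t xm' tt; rewrite [cycle _ _]/= rcons_path.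
move=> /and3P[axy _ ax] /= /and3P[_ yt _].
have yE : y = prd x by apply: adjV_top axy _; apply: xm'; rewrite !inE eqxx orbT.
have lE : last y t = prd x.
  apply: adjV_top; first by rewrite adjV_sym.
  by apply: xm'; rewrite inE mem_last orbT.
case: t tt yt lE {ax xm'} => // a t _ /= /negP yt lE.
by case: yt; rewrite yE -lE mem_last.
Qed.

Let adjV_degree x : ([set y | adjV x y] #= `I_p.+1)%card.
Proof.
pose f n := if n is m.+1 then scc x m%:R else prd x.
have -> : [set y | adjV x y] = f @` `I_p.+1.
  apply/seteqP; split=> y /= => [/orP[/eqP ->|/eqP/prdE ->]|[[|m] _ <-]].
  - by exists 0%N.
  - exists (((y.2)`_0)%R : 'Z_p).+1; last by rewrite /f natr_Zp.
    by rewrite /= ltnS -[leqRHS](Zp_cast hp) ltn_ord.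
  - by rewrite /adjV eqxx.
  by rewrite /adjV sccK eqxx orbT.
have nE y l : prd y != scc y l.
  by apply/eqP => /(congr1 fst) /=; lia.
apply: inj_card_eq => -[|m] [|n]; rewrite !inE //= ?ltnS => mp np /eqP.
- by rewrite (negPf (nE _ _)).
- by rewrite eq_sym (negPf (nE _ _)).
rewrite xpair_eqE eqxx /= => /eqP/addrI/polyC_inj/(congr1 val) /=.
by rewrite !val_Zp_nat // !modn_small // => ->.
Qed.

Let ray0 (n : nat) : V := iter n prd (0, 0).

Let ray0_geodesic : geodesic_ray adjV ray0.
Proof.
apply: (simple_geodesic_ray adjV_sym adjV_acyclic) => [k|i j].
  by rewrite /adjV /ray0 /= eqxx.
by rewrite /ray0 !iter_prd => /(congr1 fst) /=; lia.
Qed.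

Definition horo_tree_model : horo_tree p :=
  @HoroTree p V adjV adjV_sym adjV_irr adjV_connected adjV_acyclic adjV_degree
    (0, 0) _ (ex_intro2 _ _ ray0 ray0_geodesic erefl).

End HoroTreeModel.

(* Main.v *)
From HB Require Import structures.
Require Import Defs.
From mathcomp Require Import all_boot all_order all_algebra.
From mathcomp Require Import all_classical topology.
From mathcomp Require Import zify ring.

(** The idea is to write both trees in terms of the lamplighter group itself.

    Label the successors of every vertex bijectively by the cyclic group of
    order p, with label 0 along the ray from the root to the end
    ([labelling_ex]).  A vertex at level k is then the same thing as the word of
    labels met on the way to the end, that is, as the lower half of a
    configuration: its restriction to the positions up to k.  So every group
    element u, a configuration with a position k, determines a vertex [vtx u] at
    level k, every vertex arises, and [vtx u = vtx v] exactly when the positions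
    and the lower halves agree ([vtx_eq]).  Left multiplication respects this
    and commutes with predecessors, so the group acts on the tree by affine
    automorphisms ([tree_action]).

    The reflection [flip] is an automorphism of the group that exchanges lower
    and upper halves and negates the position.  A vertex of the horocyclic
    product is a pair of vertices at opposite levels, hence a pair of
    complementary halves, hence a single group element: the map from u to
    [(vtx u, vtx (flip u))] is a bijection onto the horocyclic product
    ([pair_vtx_inj], [pair_vtx_surj]).  Going up one step in the first tree and
    down one step in the second leaves both remaining halves alone and chooses
    the lamp at the new position freely, which is the right multiplication by
    some [(delta 1 l, 1)] ([up_edgeP]); so the bijection is an isomorphism with
    the Cayley graph.

    The same bijection is the orbit map of a base point for the action
    [diagonal_action] through the pairs of automorphisms given by u and
    [flip u], so this action is simply transitive.  Freeness makes it injective,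
    with discrete image since stabilisers are open.  Transitivity shows that the stabiliser of the base
    point meets every coset of the image, and this stabiliser is compact because
    its orbits on vertices are finite ([compact_stabiliser]); hence the quotient
    is compact. *)

Set Implicit Arguments.
Unset Strict Implicit.
Unset Printing Implicit Defensive.

Import Order.TTheory GRing.Theory Num.Theory.

Local Open Scope classical_set_scope.
Local Open Scope ring_scope.

(** * Levels and successors in the tree *)

Section TreeFacts.
Context {p : nat} {T : horo_tree p}.
Implicit Types x y : T.

Local Notation prd := (@pred_vertex p T).
Local Notation lv := (busemann T).
Local Notation o := (Defs.root T).

Lemma busemann_pred x : lv (prd x) = lv x - 1.
Proof. by have [_ /(_ x) ->] := busemannP (T := T); rewrite addrK. Qed.

Lemma busemann_iter n x : lv (iter n prd x) = lv x - n%:Z.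
Proof. by elim: n => [|n IH] /=; rewrite ?subr0 // busemann_pred IH; lia. Qed.

Lemma busemann_root : lv o = 0.
Proof. by have [] := busemannP (T := T). Qed.

Lemma iter_pred_meet_level x y : lv x = lv y ->
  exists n, iter n prd x = iter n prd y.
Proof.
move=> xy; have [m [n mn]] := iter_pred_meet x y.
have := congr1 lv mn; rewrite !busemann_iter xy => mnE.
by exists m; rewrite mn; congr (iter _ _ _); lia.
Qed.

Lemma pred_neq_successor x y : prd y = x -> y != prd x.
Proof.
move=> /(congr1 lv) yx; apply/eqP => /(congr1 lv).
by rewrite busemann_pred -yx busemann_pred; lia.
Qed.

Lemma adj_successors x :
  [set y | adj x y] = prd x |` [set y | prd y = x].
Proof.
apply/seteqP; split=> y /=.
  by move=> /adjP[->|->]; [left|right].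
by case=> [->|<-]; apply/adjP; [left|right].
Qed.

(** Of the p + 1 neighbours of x exactly one is its predecessor. *)
Lemma card_successors x : ([set y | prd y = x] #= `I_p)%card.
Proof.
have Ap := adj_degree x; rewrite adj_successors in Ap.
have [m Sm] : finite_set [set y | prd y = x].
  have fA : finite_set (prd x |` [set y | prd y = x]) by exists p.+1.
  by apply: sub_finite_set fA => y; right.
suff /card_eq_II[mp] : (`I_m.+1 #= `I_p.+1)%card by rewrite mp in Sm.
apply: card_eq_trans Ap; rewrite card_eq_sym; apply/eq_cardSP.
exists (prd x); first by left.
rewrite setDUl setDv set0U not_setD1 //= => xx.
by have := pred_neq_successor xx; rewrite eqxx.
Qed.

Lemma finite_successors x : finite_set [set y | prd y = x].
Proof. by exists p; exact: card_successors. Qed.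

Lemma finite_iter_successors n x : finite_set [set y | iter n prd y = x].
Proof.
elim: n x => [|n IH] x; first exact: finite_set1.
suff -> : [set y | iter n.+1 prd y = x] =
    \bigcup_(z in [set z | prd z = x]) [set y | iter n prd y = z].
  by apply: bigcup_finite => //; exact: finite_successors.
apply/seteqP; split=> y /=; first by exists (iter n prd y).
by case=> z /= <- <-.
Qed.

(** The label 0 along the ray from the root to the end makes the labels met from
    any vertex towards the end eventually 0, since that way runs into this ray:
    this is why words of labels have finite support. *)
Definition is_labelling (lab : T -> 'Z_p) :=
  (forall x, set_bij [set y | prd y = x] [set: 'Z_p] lab) /\
  (forall n, lab (iter n prd o) = 0).

(** Any choice of bijections on successors becomes a labelling once the labels
    below each vertex are translated so that the vertex of the ray from the
    root gets 0. *)
Lemma labelling_ex : (1 < p)%N -> exists lab, is_labelling lab.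
Proof.
move=> p1; have /choice[f fP] x : exists f : T -> 'Z_p,
    set_bij [set y | prd y = x] [set: 'Z_p] f.
  have /card_set_bijP[g [gI ginj gsurj]] := card_successors x.
  have gmod y : prd y = x -> (g y %% p)%N = g y.
    by move=> yx; rewrite modn_small //; apply: gI.
  exists (fun y => (g y)%:R); split=> // [y z|l _].
    rewrite !inE /= => yx zx /(congr1 val); rewrite /= !val_Zp_nat // !gmod //.
    by apply: ginj; rewrite inE.
  have [|y yx yl] := gsurj l; first by rewrite /= -[X in (_ < X)%N](Zp_cast p1).
  by exists y => //; rewrite yl natr_Zp.
(* The successor of x on the ray from the root to the end, if x lies on it. *)
pose c x := xget o [set y | prd y = x /\ exists n, y = iter n prd o].
exists (fun y => f (prd y) y - f (prd y) (c (prd y))); split=> [x|n].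
  have [f1 f2 f3] := fP x; split=> // [y z|l _].
    rewrite !inE /= => yx zx; rewrite yx zx => /addIr.
    by apply: f2; rewrite inE.
  have [y yx yl] := f3 (l + f x (c x)) I.
  by exists y => //; rewrite yx yl addrK.
suff -> : c (prd (iter n prd o)) = iter n prd o by rewrite subrr.
rewrite /c; case: xgetP => [y yE [+ [m ym]]|/(_ (iter n prd o))[]].
  by rewrite ym -!iterS => /iter_pred_inj[->].
by split=> //; exists n.
Qed.

End TreeFacts.

(** * Group elements as configurations with a position *)

Lemma lamp_mulE p (u v : lamplighter p) j :
  (u * v)%g.1 j = u.1 j + v.1 (j - u.2).
Proof. by []. Qed.

Lemma lamp_mul2 p (u v : lamplighter p) : (u * v)%g.2 = u.2 + v.2.
Proof. by []. Qed.

Lemma lamp_eq p (u v : lamplighter p) : u.1 =1 v.1 -> u.2 = v.2 -> u = v.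
Proof. by case: u v => [e k] [f l] /= /config_eq -> ->. Qed.

Lemma deltaE p (k : int) (l : 'Z_p) j : delta k l j = if j == k then l else 0.
Proof. by []. Qed.

Section Configurations.
Context {p : nat}.
Implicit Types (e f : config p) (j k : int).

Lemma config_bounded e : exists N : nat, forall j, (N < `|j|)%N -> e j = 0.
Proof.
have /asboolP/finite_seqP[s sE] := cfun_finsupp e.
exists (\max_(x <- s) `|x|)%N => j; rewrite ltnNge => /negP Nj.
apply: contrapT => /eqP ej; apply: Nj; apply: leq_bigmax_seq => //.
by have : [set x | e x != 0] j by []; rewrite sE.
Qed.

(** With [config_bounded], this turns finiteness of a support into a bound on
    absolute values, on which linear arithmetic can decide. *)
Lemma bounded_finsupp (f : int -> 'Z_p) (N : nat) :
  (forall j, (N < `|j|)%N -> f j = 0) -> finsupp_pred f.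
Proof.
move=> fN; apply/asboolP.
apply: (@sub_finite_set _ _ ((fun n : nat => n%:Z - N%:Z) @` `I_(N + N).+1)).
  move=> j /= fj; have jN : (`|j| <= N)%N.
    by rewrite leqNgt; apply: contra_neqN fj => /fN.
  by exists (absz (j + N%:Z)); [rewrite /=; lia | lia].
exact/finite_image/finite_II.
Qed.

Lemma splice_ex k e f :
  exists w : config p, forall j, w j = if j <= k then e j else f j.
Proof.
have [N eN] := config_bounded e; have [M fM] := config_bounded f.
suff wP : finsupp_pred (fun j => if j <= k then e j else f j).
  by exists (Config wP).
apply: (@bounded_finsupp _ (N + M)) => j jN.
by case: ifP => _; [apply: eN | apply: fM]; lia.
Qed.

End Configurations.

(** * Vertices as words of lamps *)

Section Vertices.
Context {p : nat} {T : horo_tree p}.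
Variable lab : T -> 'Z_p.
Hypothesis labP : is_labelling lab.
Implicit Types (x y : T) (u v : lamplighter p).

Local Notation prd := (@pred_vertex p T).
Local Notation lv := (busemann T).
Local Notation o := (Defs.root T).

(** The word of labels met from x towards the end is the configuration of u read
    downwards from the position of the lamplighter; the lamps above that
    position are ignored. *)
Definition reads u x :=
  lv x = u.2 /\ forall n : nat, lab (iter n prd x) = u.1 (u.2 - n%:Z).

Lemma lab_inj x y : prd x = prd y -> lab x = lab y -> x = y.
Proof.
move=> xy; have [/(_ (prd y))[_ labI _] _] := labP.
by apply: labI; rewrite inE.
Qed.

(** Two vertices of one level have a common ancestor at the same distance, and
    equal labels lead down from it along the same path. *)
Lemma word_inj x y : lv x = lv y ->
  (forall n, lab (iter n prd x) = lab (iter n prd y)) -> x = y.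
Proof.
move=> xy lxy; have [n] := iter_pred_meet_level xy.
elim: n => // n IH /= nxy.
by apply: IH; apply: lab_inj nxy (lxy n).
Qed.

Lemma reads_inj u x y : reads u x -> reads u y -> x = y.
Proof.
by move=> [xu lx] [yu ly]; apply: word_inj => [|n]; rewrite ?xu ?lx ?ly.
Qed.

Lemma reads_pred u x : reads u x -> reads (u.1, u.2 - 1) (prd x).
Proof.
move=> [xu lx]; split=> [|n]; first by rewrite busemann_pred xu.
by rewrite -iterSr lx /=; congr (u.1 _); lia.
Qed.

Lemma reads_successor (e : config p) (k : int) x :
  reads (e, k) x -> exists y, reads (e, k + 1) y.
Proof.
move=> [/= xk lx]; have [/(_ x)[_ _ labS] _] := labP.
have [y yx ly] := labS (e (k + 1)) I.
exists y; split=> [|[|n]] /=.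
- by rewrite -xk -yx busemann_pred subrK.
- by rewrite ly subr0.
by rewrite -iterS iterSr yx lx; congr (e _); lia.
Qed.

(** Far below the support of the configuration the word is 0, so it is read at a
    vertex of the ray from the root to the end; from there the lamps prescribe
    the successor to take at each level. *)
Lemma reads_vertex_ex u : exists x, reads u x.
Proof.
case: u => e k; have [N eN] := config_bounded e.
have [M NM] : exists M, (N + `|k| < M)%N by exists (N + `|k|).+1.
have lowest : exists x, reads (e, - M%:Z) x.
  exists (iter M prd o); split=> [|n] /=.
    by rewrite busemann_iter busemann_root sub0r.
  by rewrite -iterD labP.2 eN //; lia.
have up n : exists x, reads (e, - M%:Z + n%:Z) x.
  elim: n => [|n [x xn]]; first by rewrite addr0.
  by have := reads_successor xn; rewrite -addrA -PoszD addn1.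
have := up (absz (M%:Z + k)); rewrite gez0_abs ?addKr //.
by lia.
Qed.

Lemma reads_word_ex x : exists u, reads u x.
Proof.
pose e j : 'Z_p := if j <= lv x then lab (iter (absz (lv x - j)) prd x) else 0.
have [m [n mn]] := iter_pred_meet x o.
have eP : finsupp_pred e.
  apply: (@bounded_finsupp _ _ (m + `|lv x|)) => j jN; rewrite /e.
  case: ifP => // jx; have -> : absz (lv x - j) = (absz (lv x - j) - m + m)%N.
    by lia.
  by rewrite iterD mn -iterD labP.2.
exists (Config eP, lv x); split=> //= i; rewrite /e.
rewrite ifT; last by lia.
by congr (lab (iter _ _ _)); lia.
Qed.

(** The tree is thus the set of left cosets, in the lamplighter group, of the
    configurations supported above 0: [vtx] is the projection ([vtx_surj],
    [vtx_eq]). *)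
Definition vtx u : T := xget o (reads u).

Lemma vtxP u : reads u (vtx u).
Proof. by apply: xgetPex; exact: reads_vertex_ex. Qed.

Lemma vtx_unique u x : reads u x -> vtx u = x.
Proof. exact/reads_inj/vtxP. Qed.

Lemma vtx_surj x : exists u, vtx u = x.
Proof. by have [u ux] := reads_word_ex x; exists u; exact: vtx_unique. Qed.

Lemma busemann_vtx u : lv (vtx u) = u.2.
Proof. by have [] := vtxP u. Qed.

Lemma pred_vtx u : prd (vtx u) = vtx (u.1, u.2 - 1).
Proof. by apply/esym/vtx_unique/reads_pred/vtxP. Qed.

Lemma vtx_eq u v :
  vtx u = vtx v <-> u.2 = v.2 /\ forall j, j <= u.2 -> u.1 j = v.1 j.
Proof.
have [_ lu] := vtxP u; have [_ lv] := vtxP v.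
split=> [uv|[uv2 uv1]].
  have uv2 : u.2 = v.2 by rewrite -!busemann_vtx uv.
  split=> // j ju; have := lu (absz (u.2 - j)).
  rewrite gez0_abs ?subr_ge0 // subKr => <-.
  by rewrite uv lv -uv2 gez0_abs ?subr_ge0 // subKr.
apply: vtx_unique; split=> [|n]; first by rewrite busemann_vtx.
by rewrite lv -uv2 uv1 //; lia.
Qed.

End Vertices.

(** * The action on the tree and on the horocyclic product *)

(** A bijection that commutes with predecessors is an automorphism, since the
    edges are exactly the pairs of a vertex and its predecessor. *)
Lemma aff_pred_bij p (T : horo_tree p) (g : T -> T) : bijective g ->
  (forall x, g (pred_vertex x) = pred_vertex (g x)) -> aff_pred g.
Proof.
move=> bg pg; apply/asboolP; split=> //; split=> // x y.
have gI := bij_inj bg.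
apply/idP/idP => /adjP xy; apply/adjP.
  by case: xy; rewrite -pg => /gI; [left|right].
by case: xy => ->; rewrite pg; [left|right].
Qed.

Lemma aff_mulE p (T : horo_tree p) (g h : aff T) x : (g * h)%g x = g (h x).
Proof. by []. Qed.

Lemma aff_predE p (T : horo_tree p) (g : aff T) x :
  g (pred_vertex x) = pred_vertex (g x).
Proof. by have /asboolP[_ ->] := aff_funP g. Qed.

Lemma aff_iter_pred p (T : horo_tree p) (g : aff T) n x :
  g (iter n pred_vertex x) = iter n pred_vertex (g x).
Proof. by elim: n => //= n <-; rewrite aff_predE. Qed.

Lemma horoprod_mulE1 p (T : horo_tree p) (g h : horoprod T) x :
  (g * h)%g.1 x = g.1 (h.1 x).
Proof. by []. Qed.

Lemma horoprod_mulE2 p (T : horo_tree p) (g h : horoprod T) x :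
  (g * h)%g.2 x = g.2 (h.2 x).
Proof. by []. Qed.

Section Flip.
Context {p : nat}.
Implicit Types (e : config p) (u v : lamplighter p).

Lemma reflection_subproof e : finsupp_pred (fun j => e (1 - j)).
Proof.
have [N eN] := config_bounded e.
by apply: (@bounded_finsupp _ _ N.+1) => j jN; apply: eN; lia.
Qed.

Definition reflection e : config p := Config (reflection_subproof e).

(** The second tree sees the lamps above the lamplighter, read downwards.  The
    position j > k corresponds there to the level 1 - j, because the second
    tree is at level - k; with this shift by one the two readings together meet
    every lamp once. *)
Definition flip u : lamplighter p := (reflection u.1, - u.2).

Lemma flipE u j : (flip u).1 j = u.1 (1 - j).
Proof. by []. Qed.

Lemma flipM u v : flip (u * v)%g = (flip u * flip v)%g.
Proof.
apply: lamp_eq => [j|]; last exact: opprD.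
rewrite lamp_mulE !flipE lamp_mulE; congr (_ + v.1 _).
by rewrite /= opprK; ring.
Qed.

End Flip.

Section Action.
Context {p : nat} {T : horo_tree p}.
Variable lab : T -> 'Z_p.
Hypothesis labP : is_labelling lab.
Implicit Types (x y : T) (g u v : lamplighter p).

Local Notation prd := (@pred_vertex p T).
Local Notation lv := (busemann T).
Local Notation vtx := (vtx lab).

(** Taking predecessors is a right multiplication, so it commutes with all left
    multiplications. *)
Lemma pred_vtx_mul u : prd (vtx u) = vtx (u * (0, -1))%g.
Proof.
rewrite pred_vtx //; congr (vtx _); apply: lamp_eq => // j.
by rewrite lamp_mulE addr0.
Qed.

(** Left multiplication adds a fixed configuration and shifts, so what it
    yields below the lamplighter depends only on what was below it. *)
Lemma vtx_mul g u v : vtx u = vtx v -> vtx (g * u)%g = vtx (g * v)%g.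
Proof.
move=> /(vtx_eq labP)[uv2 uv1]; apply/vtx_eq => //; split.
  by rewrite !lamp_mul2 uv2.
by move=> j; rewrite lamp_mul2 => ju; rewrite !lamp_mulE uv1 //; lia.
Qed.

(** By [vtx_mul] the word chosen for x is irrelevant. *)
Definition translate g x : T := vtx (g * xget g [set u | vtx u = x])%g.

Lemma translate_vtx g u : translate g (vtx u) = vtx (g * u)%g.
Proof.
by apply: vtx_mul; apply: (@xgetPex _ g [set v | _ v = _]); exists u.
Qed.

Lemma translate_cancel g h :
  (h * g = 1)%g -> cancel (translate g) (translate h).
Proof.
move=> hg x; have [u <-] := vtx_surj labP x.
by rewrite !translate_vtx mulgA hg mul1g.
Qed.

Lemma translate_pred g x : translate g (prd x) = prd (translate g x).
Proof.
have [u <-] := vtx_surj labP x.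
by rewrite pred_vtx_mul !translate_vtx pred_vtx_mul mulgA.
Qed.

Lemma translate_aff g : aff_pred (translate g).
Proof.
apply: aff_pred_bij; last exact: translate_pred.
by exists (translate g^-1%g); apply: translate_cancel; rewrite ?mulVg ?mulgV.
Qed.

Definition tree_action g : aff T := Aff (translate_aff g).

Lemma tree_action_vtx g u : tree_action g (vtx u) = vtx (g * u)%g.
Proof. exact: translate_vtx. Qed.

Lemma tree_actionM g h :
  tree_action (g * h)%g = (tree_action g * tree_action h)%g.
Proof.
apply: aff_eq => x; have [u <-] := vtx_surj labP x.
by rewrite aff_mulE !tree_action_vtx mulgA.
Qed.

Lemma Phi_tree_action g : Phi (tree_action g) = g.2.
Proof.
rewrite (PhiE _ (vtx 1%g)) tree_action_vtx !busemann_vtx // mulg1.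
exact: subr0.
Qed.

Definition diagonal_action g : horoprod T :=
  @Horoprod p T (tree_action g, tree_action (flip g)) (introT eqP
    (etrans (congr2 +%R (Phi_tree_action g) (Phi_tree_action (flip g)))
            (addrN g.2))).

Lemma diagonal_actionM : {morph diagonal_action : g h / (g * h)%g}.
Proof.
by move=> g h; apply: val_inj; congr (_, _); rewrite ?flipM tree_actionM.
Qed.

Lemma pair_vtx_inj u v :
  vtx u = vtx v -> vtx (flip u) = vtx (flip v) -> u = v.
Proof.
move=> /(vtx_eq labP)[uv2 uv1] /(vtx_eq labP)[_ uv1'].
apply: lamp_eq => // j; have [ju|uj] := lerP j u.2; first exact: uv1.
have := uv1' (1 - j); rewrite !flipE subKr; apply.
by rewrite /=; lia.
Qed.

(** The first word prescribes the lamps up to the lamplighter, the second one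
    those above: together they are one configuration. *)
Lemma pair_vtx_surj x y : lv x + lv y = 0 ->
  exists u, vtx u = x /\ vtx (flip u) = y.
Proof.
have [u <-] := vtx_surj labP x; have [v <-] := vtx_surj labP y.
rewrite !busemann_vtx // => uv.
have [w wE] := splice_ex u.2 u.1 (flip v).1.
exists (w, u.2); split; apply/vtx_eq => //; split=> //.
- by move=> j /= ju; rewrite wE ju.
- by rewrite /=; lia.
move=> j /= ju; rewrite -[LHS]/(w (1 - j)) wE ifF; last by apply/negP; lia.
by rewrite flipE subKr.
Qed.

End Action.

(** * The generators and the Cayley graph *)

Section Generators.
Context {p : nat}.
Implicit Types (u v : lamplighter p) (l : 'Z_p).

Definition up_gen l : lamplighter p := (delta 1 l, 1).
Definition down_gen l : lamplighter p := (delta 0 l, -1).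

Lemma down_genE l : down_gen l = (up_gen (- l))^-1%g.
Proof.
apply: lamp_eq => // j.
rewrite -[RHS]/(- (delta 1 (- l) (j - - 1))) !deltaE.
have -> : (j - - 1 == 1) = (j == 0) by apply/eqP/eqP; lia.
by case: eqP; rewrite ?opprK ?oppr0.
Qed.

Lemma lamp_gensP u :
  lamp_gens p u <-> (exists l, u = up_gen l) \/ (exists l, u^-1%g = up_gen l).
Proof.
split=> [[[l _ <-]|[l _ <-]]|[[l ->]|[l ul]]].
- by left; exists l.
- by right; exists (- l); rewrite -[X in (X^-1)%g]/(down_gen l) down_genE invgK.
- by left; exists l.
right; exists (- l) => //.
by rewrite -[LHS]/(down_gen (- l)) down_genE opprK -ul invgK.
Qed.

Lemma finite_lamp_gens : finite_set (lamp_gens p).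
Proof.
by rewrite finite_setU; split; apply: finite_image; exact: finite_finset.
Qed.

Lemma symmetric_lamp_gens : symmetric_set (lamp_gens p).
Proof.
by move=> u /lamp_gensP[] ul; apply/lamp_gensP; [right|left]; rewrite ?invgK.
Qed.

Lemma lamp_edgeP u v : (exists2 s, lamp_gens p s & v = (u * s)%g) <->
  (exists l, v = (u * up_gen l)%g) \/ (exists l, u = (v * up_gen l)%g).
Proof.
split=> [[s /lamp_gensP[[l ->]|[l sl]] ->]|[[l ->]|[l ->]]].
- by left; exists l.
- by right; exists l; rewrite -sl mulgK.
- by exists (up_gen l) => //; apply/lamp_gensP; left; exists l.
exists (up_gen l)^-1%g; last by rewrite mulgK.
by apply/lamp_gensP; right; exists l; rewrite invgK.
Qed.

Local Notation lamp e k := ((e%R, k%R) : lamplighter p).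

(** Moves of the lamplighter are powers of a generator; a lamp is switched by
    going there, using a generator and going back; a configuration is a finite
    sum of single lamps. *)
Lemma generates_lamp_gens : generates (lamp_gens p).
Proof.
move=> H genH.
have upH l : up_gen l \in H by apply: genH; apply/lamp_gensP; left; exists l.
have moveH (k : int) : lamp 0 k \in H.
  have oneH : lamp 0 1 \in H.
    suff <- : up_gen 0 = lamp 0 1 by [].
    by apply: lamp_eq => // j; rewrite deltaE if_same.
  have natH (n : nat) : lamp 0 n%:Z \in H.
    elim: n => [|n IH]; first exact: gpred1.
    suff -> : lamp 0 (n.+1%:Z) = (lamp 0 n%:Z * lamp 0 1)%g.
      exact: gpredM.
    apply: lamp_eq => [j|]; first by rewrite lamp_mulE addr0.
    by rewrite lamp_mul2 /=; lia.
  case: k => n; first exact: natH.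
  suff -> : lamp 0 (Negz n) = (lamp 0 n.+1%:Z)^-1%g.
    by rewrite gpredV.
  by apply: lamp_eq => // j; exact/esym/oppr0.
have deltaH (k : int) l : lamp (delta k l) 0 \in H.
  suff -> : lamp (delta k l) 0 =
      (lamp 0 (k - 1) * up_gen l * lamp 0 (- k))%g.
    by rewrite !gpredM.
  apply: lamp_eq => [j|]; last by rewrite !lamp_mul2 /=; lia.
  rewrite !lamp_mulE addr0 add0r !deltaE.
  by congr (if _ then _ else _); apply/eqP/eqP => /= ?; lia.
have supportH (s : seq int) (e : config p) :
    (forall j, j \notin s -> e j = 0) -> lamp e 0 \in H.
  elim: s e => [|k s IH] e es.
    suff -> : e = 0 by exact: gpred1.
    by apply: config_eq => j; exact: es.
  have -> : lamp e 0 = (lamp (delta k (e k)) 0 * lamp (e - delta k (e k)) 0)%g.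
    apply: lamp_eq => // j.
    by rewrite lamp_mulE subr0 configD configN addrCA subrr addr0.
  apply: gpredM => //; apply: IH => j js.
  rewrite configD configN deltaE; case: eqP => [->|/eqP jk]; first exact: subrr.
  by rewrite es ?subr0 // inE negb_or jk.
case=> e k; have /asboolP/finite_seqP[s sE] := cfun_finsupp e.
have -> : lamp e k = (lamp e 0 * lamp 0 k)%g.
  apply: lamp_eq => [j|]; first by rewrite lamp_mulE addr0.
  by rewrite lamp_mul2 add0r.
apply: gpredM => //; apply: (supportH s) => j js.
apply: contraNeq js => ej.
by have : [set x | e x != 0] j by []; rewrite sE.
Qed.

End Generators.

Section DLGraph.
Context {p : nat} {T : horo_tree p}.
Variable lab : T -> 'Z_p.
Hypothesis labP : is_labelling lab.
Implicit Types (u v : lamplighter p).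

Local Notation prd := (@pred_vertex p T).
Local Notation lv := (busemann T).
Local Notation vtx := (vtx lab).

(** An edge of the horocyclic product goes up in one tree and down in the
    other; this one goes up in the first tree. *)
Definition is_up_edge u v :=
  vtx u = prd (vtx v) /\ vtx (flip v) = prd (vtx (flip u)).

(** The first tree says that the lamps up to the old position are unchanged, the
    second that those above the new position are: only the lamp at the new
    position is free. *)
Lemma up_edgeP u v : is_up_edge u v <-> exists l, v = (u * up_gen l)%g.
Proof.
rewrite /is_up_edge !pred_vtx //; split=> [[]|[l ->]].
  move=> /(vtx_eq labP)[/= uv2 uv1] /(vtx_eq labP)[_ vu1].
  exists (v.1 v.2 - u.1 v.2); apply: lamp_eq => [j|]; last first.
    by rewrite lamp_mul2 uv2 /=; lia.
  rewrite lamp_mulE deltaE (_ : (j - u.2 == 1) = (j == v.2)); last first.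
    by apply/eqP/eqP; lia.
  case: (ltrgtP j v.2) => [jv|vj|->]; last by rewrite addrC subrK.
    by rewrite addr0 uv1 //; lia.
  have := vu1 (1 - j); rewrite flipE subKr => ->; last by rewrite /=; lia.
  by rewrite addr0 -[LHS]/(u.1 (1 - (1 - j))) subKr.
split; apply/(vtx_eq labP); split=> [|j].
- by rewrite lamp_mul2 addrK.
- move=> ju; rewrite lamp_mulE deltaE ifF ?addr0 //.
  by apply/negP => /eqP; lia.
- by rewrite /=; lia.
move=> ju; rewrite flipE lamp_mulE deltaE ifF ?addr0 //.
by apply/negP => /eqP; move: ju; rewrite /=; lia.
Qed.

Lemma pair_adjP u v :
  adj (vtx u) (vtx v) /\ adj (vtx (flip u)) (vtx (flip v)) <->
  is_up_edge u v \/ is_up_edge v u.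
Proof.
have levels w w' : vtx w = prd (vtx w') -> w'.2 = w.2 + 1.
  move=> /(congr1 lv); rewrite busemann_pred !busemann_vtx // => ->.
  by rewrite subrK.
split=> [[/adjP uv /adjP uv']|[[uv vu]|[vu uv]]]; last 2 first.
- by split; apply/adjP; [right|left].
- by split; apply/adjP; [left|right].
case: uv uv' => uv [] uv'; [exfalso| by right | by left | exfalso].
  by have := levels _ _ uv; have := levels _ _ uv'; rewrite /=; lia.
by have := levels _ _ uv; have := levels _ _ uv'; rewrite /=; lia.
Qed.

(** The isomorphism sends a vertex of the horocyclic product to the unique group
    element that spells its two words. *)
Lemma DL_iso_cayley : graph_iso (DL T) (cayley_graph (lamp_gens p)).
Proof.
have DLP u : DL_pred (vtx u, vtx (flip u)).
  by apply/eqP; rewrite /= !busemann_vtx //; exact: addrN.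
pose w u : gvertex (DL T) := exist _ (vtx u, vtx (flip u)) (DLP u).
have w_surj d : exists u, w u = d.
  have [u [ux uy]] := pair_vtx_surj labP (eqP (valP d)).
  by exists u; apply: val_inj; rewrite /= ux uy -surjective_pairing.
have /choice[f fK] := w_surj.
have wK : cancel w f.
  move=> u; have := congr1 val (fK (w u)); case=> fu fu'.
  exact: pair_vtx_inj fu fu'.
exists f; split; first by exists w.
move=> d d'; rewrite -(fK d) -(fK d') !wK /=.
rewrite (propext (pair_adjP _ _)) (propext (lamp_edgeP _ _)).
by rewrite !(propext (up_edgeP _ _)).
Qed.

End DLGraph.

(** * Compactness of vertex stabilisers *)

Lemma ultra_finite_value (X : Type) (Y : choiceType) (F : set_system X)
    (c : X -> Y) (A : set Y) : UltraFilter F -> finite_set A ->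
  F (c @^-1` A) -> exists z, F [set i | c i = z].
Proof.
move=> FU /finite_seqP[s ->]; elim: s => [|a s IH] Fs.
  by have [] := filter_ex Fs.
have [Fa|Fa] := in_ultra_setVsetC [set i | c i = a] FU; first by exists a.
apply: IH; apply: filterS (filterI Fs Fa) => i [] /=.
by rewrite inE => /predU1P[].
Qed.

Lemma initial_cvg (S : choiceType) (U : topologicalType) (f : S -> U)
    (F : set_system S) (s : S) : Filter F ->
  f @ F --> f s -> F --> (s : initial_topology f).
Proof.
move=> FF fs A; rewrite nbhsE => -[B [[C oC <-] Cs] CA].
by apply: filterS CA _; apply: fs; apply: open_nbhs_nbhs.
Qed.

Lemma ptws_cvg (X I : Type) (Y : choiceType) (F : set_system X)
    (c : X -> I -> Y) (f : I -> Y) :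
  Filter F -> (forall x, F [set i | c i x = f x]) ->
  c @ F --> (f : {ptws I -> discrete_topology Y}).
Proof.
move=> FF cf; apply/cvg_sup => x.
apply: initial_cvg; apply/discrete_cvg.
exact: cf.
Qed.

Section Limits.
Context {p : nat} {T : horo_tree p}.
Implicit Types (x y b : T).

Local Notation prd := (@pred_vertex p T).

(** If g fixes b, then it fixes the ancestors of b; one of them is the m-th
    ancestor of x for some m, hence also that of g x. *)
Lemma finite_orbit b x :
  exists2 A, finite_set A & forall g : aff T, g b = b -> A (g x).
Proof.
have [m [n mn]] := iter_pred_meet x b.
exists [set y | iter m prd y = iter n prd b].
  exact: finite_iter_successors.
by move=> g gb; rewrite /= -aff_iter_pred mn aff_iter_pred gb.
Qed.

(** The values at each vertex lie in a finite orbit, so the ultrafilter selects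
    one; the inverses have a pointwise limit as well, and it inverts the first
    because any two of the selected values are attained by a common element. *)
Lemma aff_ultra_limit (X : Type) (F : set_system X) (c : X -> aff T) b :
  UltraFilter F -> F [set g | c g b = b] ->
  exists g : aff T, forall x, F [set h | c h x = g x].
Proof.
move=> FU Fb.
have lim (d : X -> aff T) : F [set g | d g b = b] ->
    exists f : T -> T, forall x, F [set h | d h x = f x].
  move=> Fd; suff /choice[f fP] x : exists y, F [set h | d h x = y] by exists f.
  have [A fA Ab] := finite_orbit b x.
  by apply: (ultra_finite_value FU fA); apply: filterS Fd => h /Ab.
have [f fP] := lim c Fb.
have invb (h : aff T) : h b = b -> (h^-1)%g b = b.
  by move=> hb; rewrite -{1}hb -aff_mulE mulVg.
have [f' f'P] : exists f' : T -> T, forall x, F [set h | (c h)^-1%g x = f' x].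
  by apply: lim; apply: filterS Fb => h /invb.
have fK : cancel f f'.
  move=> x; have [h [/= <- <-]] := filter_ex (filterI (fP x) (f'P (f x))).
  by rewrite -aff_mulE mulVg.
have f'K : cancel f' f.
  move=> x; have [h [/= <- <-]] := filter_ex (filterI (f'P x) (fP (f' x))).
  by rewrite -aff_mulE mulgV.
suff fA : aff_pred f by exists (Aff fA).
apply: aff_pred_bij; first by exists f'.
move=> x; have [h [/= <- <-]] := filter_ex (filterI (fP x) (fP (prd x))).
exact: aff_predE.
Qed.

Definition stabiliser b : set (horoprod T) :=
  [set g : horoprod T | g.1 b = b /\ g.2 b = b].

Lemma horoprod_cvg (F : set_system (horoprod T)) (g : horoprod T) : Filter F ->
  (forall x, F [set h : horoprod T | h.1 x = g.1 x]) ->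
  (forall x, F [set h : horoprod T | h.2 x = g.2 x]) -> F --> g.
Proof.
move=> FF F1 F2; apply: initial_cvg.
have c1 := @ptws_cvg _ _ _ F (fun h : horoprod T => h.1 : T -> T) g.1 FF F1.
have c2 := @ptws_cvg _ _ _ F (fun h : horoprod T => h.2 : T -> T) g.2 FF F2.
move=> A [[B1 B2] [/= /c1 FB1 /c2 FB2] BA].
apply: (@filterS _ F FF) (@filterI _ F FF _ _ FB1 FB2) => h.
exact: (BA (h.1 : T -> T, h.2 : T -> T)).
Qed.

(** An ultrafilter on the stabiliser has a limit in each coordinate; that the
    levels cancel and that b is fixed can be read off one element of it. *)
Lemma compact_stabiliser b : compact (stabiliser b).
Proof.
rewrite compact_ultra => F FU Fb.
have [g1 g1P] : exists g : aff T,
    forall x, F [set h : horoprod T | h.1 x = g x].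
  by apply: (aff_ultra_limit (b := b)); apply: filterS Fb => h [].
have [g2 g2P] : exists g : aff T,
    forall x, F [set h : horoprod T | h.2 x = g x].
  by apply: (aff_ultra_limit (b := b)); apply: filterS Fb => h [].
have [h [[/= h1 h2] [hb1 hb2]]] :=
  filter_ex (filterI (filterI (g1P b) (g2P b)) Fb).
have gP : horoprod_pred (g1, g2).
  by rewrite /horoprod_pred !(PhiE _ b) /= -h1 -h2 hb1 hb2 subrr addr0.
exists (Horoprod gP); split; first by split; rewrite /= -?h1 -?h2.
exact: horoprod_cvg.
Qed.

(** Evaluation at a vertex is continuous into a discrete space. *)
Lemma nbhs_horoprod_eq (g : horoprod T) x y :
  nbhs g [set h : horoprod T | h.1 x = g.1 x /\ h.2 y = g.2 y].
Proof.
have ev : horoprod_eval h @[h --> g] --> horoprod_eval g.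
  exact: initial_continuous.
have ev1 : (horoprod_eval h).1 @[h --> g] --> (horoprod_eval g).1.
  exact: cvg_comp ev cvg_fst.
have ev2 : (horoprod_eval h).2 @[h --> g] --> (horoprod_eval g).2.
  exact: cvg_comp ev cvg_snd.
have pt (z : T) (f : {ptws T -> discrete_topology T}) :
    nbhs f [set k : {ptws T -> discrete_topology T} | k z = f z].
  apply: (@proj_continuous T (fun=> discrete_topology T) z f [set f z]).
  exact: discrete_set1.
exact: (@filterI _ _ (nbhs_filter g) _ _ (ev1 _ (pt x _)) (ev2 _ (pt y _))).
Qed.

End Limits.

(** * The lamplighter group as a cocompact lattice *)

Lemma lcoset_set_range (G G' : groupType) (f : {multiplicative G -> G'}) g u :
  lcoset_set (range f) (g * f u)%g = lcoset_set (range f) g.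
Proof.
apply/seteqP; split=> _ [_ [v _ <-] <-].
  exists (f (u * v)%g); first by exists (u * v)%g.
  by rewrite gmulfM mulgA.
exists (f (u^-1 * v)%g); first by exists (u^-1 * v)%g.
by rewrite -mulgA -gmulfM mulVKg.
Qed.

(** If K meets every left coset of the range, then the quotient is a continuous
    image of K. *)
Lemma cocompact_range p (T : horo_tree p) (G : groupType)
    (f : {multiplicative G -> horoprod T}) (K : set (horoprod T)) :
  compact K -> (forall g, exists u, K (g * f u)%g) -> cocompact (range f).
Proof.
move=> cK KG; rewrite /cocompact.
pose Q := quotient_topology (lcoset_space (range f)).
have -> : [set: Q] = \pi_Q%qT @` K.
  apply/seteqP; split=> // q _; have [u Ku] := KG (repr q).
  exists (repr q * f u)%g => //; rewrite -[RHS]reprK.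
  by apply/eqquotP/asboolP; exact: lcoset_set_range.
apply: continuous_compact cK.
exact/continuous_subspaceT/pi_continuous.
Qed.

Section Lattice.
Context {p : nat} {T : horo_tree p}.
Variable lab : T -> 'Z_p.
Hypothesis labP : is_labelling lab.
Local Notation vtx := (vtx lab).
Local Notation phi := (diagonal_action labP).

HB.instance Definition _ := isMultiplicative.Build (lamplighter p) (horoprod T)
  phi (diagonal_actionM labP).

Local Notation b := (vtx 1%g).

(** The orbit map of the base point is the bijection onto the vertices of the
    horocyclic product, so the action is simply transitive. *)
Lemma diagonal_action_base u :
  (phi u).1 b = vtx u /\ (phi u).2 b = vtx (flip u).
Proof.
by split; rewrite -[in RHS](mulg1 u) ?flipM; exact: tree_action_vtx.
Qed.

Lemma diagonal_action_base_inj u v :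
  (phi u).1 b = (phi v).1 b -> (phi u).2 b = (phi v).2 b -> u = v.
Proof.
have [-> ->] := diagonal_action_base u; have [-> ->] := diagonal_action_base v.
exact: pair_vtx_inj.
Qed.

Lemma diagonal_action_inj : injective phi.
Proof. by move=> u v uv; apply: diagonal_action_base_inj; rewrite uv. Qed.

(** An element of the lamplighter group is determined by the image of the base
    point, and to have a given image is an open condition. *)
Lemma discrete_diagonal_action : discrete_subset (range phi).
Proof.
move=> _ [u _ <-]; split; first by apply: mem_set; exists u.
exists [set h : horoprod T | h.1 b = (phi u).1 b /\ h.2 b = (phi u).2 b].
  exact: nbhs_horoprod_eq.
apply/seteqP; split=> [h [/= hb [v _ vh]]|_ ->]; last by split=> //; exists u.
case: h / vh hb => -[vu vu']; congr phi; exact: diagonal_action_base_inj.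
Qed.

(** By transitivity every g can be corrected on the right by a group element so
    that it fixes the base point: take the one with the same image of the base
    point as the inverse of g. *)
Lemma cocompact_diagonal_action : cocompact (range phi).
Proof.
apply: (cocompact_range (f := phi) (@compact_stabiliser _ _ b)) => g.
pose g' := (g^-1)%g.
have [|u [u1 u2]] := pair_vtx_surj labP (x := g'.1 b) (y := g'.2 b).
  have /eqP := horoprod_valP g'.
  by rewrite !(PhiE _ b) !busemann_vtx // !subr0.
have [ub ub'] := diagonal_action_base u.
have gb : (g * g')%g = 1%g by exact: mulgV.
exists u; split.
  by rewrite horoprod_mulE1 ub u1 -horoprod_mulE1 gb.
by rewrite horoprod_mulE2 ub' u2 -horoprod_mulE2 gb.
Qed.

End Lattice.

Theorem proposition3p1 (p : nat) (hp : (2 <= p)%N) (T : horo_tree p) :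
  (exists phi : {multiplicative lamplighter p -> horoprod T},
     [/\ injective phi,
         discrete_subset (range phi) &
         cocompact (range phi)]) /\
  [/\ finite_set (lamp_gens p),
      symmetric_set (lamp_gens p),
      generates (lamp_gens p) &
      graph_iso (DL T) (cayley_graph (lamp_gens p))].
Proof.
have [lab labP] := labelling_ex (T := T) hp.
split; first exists (diagonal_action labP); split.
- exact: diagonal_action_inj.
- exact: discrete_diagonal_action.
- exact: cocompact_diagonal_action.
- exact: finite_lamp_gens.
- exact: symmetric_lamp_gens.
- exact: generates_lamp_gens.
exact: DL_iso_cayley labP.
Qed.
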